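(* Let $n\ge 2$ and $m=n(n-1)/2$. The symmetry reduced regularised $n$-body problem has a Lie-Poisson structure with algebra $\mathfrak{u}(m,m)$. That is, the real vector space of quadratic forms on $T^*\mathbb{R}^{4m}$ that are invariant under the diagonal action $\Psi_S$, $S\in G$, is closed under the Poisson bracket and, with the Poisson bracket as Lie bracket, is isomorphic as a real Lie algebra to $\mathfrak{u}(m,m)$.
   Context: Regularised phase space of the $n$-body problem: each of the $m=\binom n2$ difference vectors between the bodies and its difference momentum is represented by a pair $(\boldsymbol{Q}_i,\boldsymbol{P}_i)\in\mathbb{R}^4\times\mathbb{R}^4$ (quaternions viewed as column vectors), $i=1,\dots,m$. The phase space is $T^*\mathbb{R}^{4m}$ with coordinates $(\boldsymbol{Q}_1,\dots,\boldsymbol{Q}_m,\boldsymbol{P}_1,\dots,\boldsymbol{P}_m)$ and the standard Poisson bracket: the components satisfy $\{Q_{i,a},P_{j,b}\}=\delta_{ij}\delta_{ab}$, all other brackets of coordinates being zero. Symmetry group: let $$K=\begin{pmatrix}0&0&0&-1\\0&0&1&0\\0&-1&0&0\\1&0&0&0\end{pmatrix},\qquad \operatorname{Isoc}(\hat{\boldsymbol L})=\begin{pmatrix}\hat{\boldsymbol L}&-\boldsymbol L\\ \boldsymbol L^{t}&0\end{pmatrix}\quad(\boldsymbol L\in\mathbb{R}^3),$$ where $\hat{\boldsymbol L}$ is the skew $3\times3$ matrix with $\hat{\boldsymbol L}\boldsymbol v=\boldsymbol L\times\boldsymbol v$. Let $G\subset SO(4)$ be the subgroup of all matrices $\exp\!\big(\tfrac12(\operatorname{Isoc}(\hat{\boldsymbol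 L})+\tau K)\big)$, $\boldsymbol L\in\mathbb{R}^3$, $\tau\in\mathbb{R}$. For $S\in G$ the diagonal action is $\Psi_S:(\boldsymbol{Q}_i,\boldsymbol{P}_i)_{i=1}^m\mapsto(S\boldsymbol{Q}_i,S\boldsymbol{P}_i)_{i=1}^m$. The symmetry reduction is carried out by using the quadratic invariants of $\Psi_S$ as coordinates. $\mathfrak{u}(m,m)$ is the real Lie algebra, under the commutator, of complex $2m\times2m$ matrices $M$ with $(HM)^\dagger+HM=0$, where $H$ is a fixed Hermitian matrix of signature $(m,m)$, e.g. $H=i\begin{pmatrix}0&I_m\\-I_m&0\end{pmatrix}$. *)

(* Defs.v *)
From HB Require Import structures.
From mathcomp Require Import all_boot all_order all_algebra.
From mathcomp Require Import spectral sesquilinear complex.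
From mathcomp Require Import all_classical all_reals all_analysis.

Set Implicit Arguments.
Unset Strict Implicit.
Unset Printing Implicit Defensive.

Import Order.TTheory GRing.Theory Num.Theory.
Import numFieldNormedType.Exports.

Local Open Scope classical_set_scope.
Local Open Scope ring_scope.
Local Open Scope complex_scope.
Local Open Scope sesquilinear_scope.

Section LieAlgebras.
Variable R : realType.

(* The subset A of V is a real vector space, and br is a Lie bracket on A;
   nothing is required of br outside A. *)
Record is_lie_algebra (V : lmodType R) (A : set V) (br : V -> V -> V) : Prop :=
  IsLieAlgebra {
    lie_0 : A 0;
    lie_linear_closed : forall (a : R) x y, A x -> A y -> A (a *: x + y);
    lie_br_closed : forall x y, A x -> A y -> A (br x y);
    lie_brDl : forall (a : R) x y z, A x -> A y -> A z ->
      br (a *: x + y) z = a *: br x z + br y z;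
    lie_brDr : forall (a : R) x y z, A x -> A y -> A z ->
      br x (a *: y + z) = a *: br x y + br x z;
    lie_alt : forall x, A x -> br x x = 0;
    lie_jacobi : forall x y z, A x -> A y -> A z ->
      br x (br y z) + br y (br z x) + br z (br x y) = 0 }.

Record is_lie_isomorphism (V W : lmodType R)
    (A : set V) (brA : V -> V -> V) (B : set W) (brB : W -> W -> W)
    (phi : V -> W) : Prop := IsLieIsomorphism {
  lie_iso_bij : set_bij A B phi;
  lie_iso_linear : forall (a : R) x y, A x -> A y ->
    phi (a *: x + y) = a *: phi x + phi y;
  lie_iso_br : forall x y, A x -> A y -> phi (brA x y) = brB (phi x) (phi y) }.

Definition lie_isomorphic (V W : lmodType R)
    (A : set V) (brA : V -> V -> V) (B : set W) (brB : W -> W -> W) : Prop :=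
  [/\ is_lie_algebra A brA, is_lie_algebra B brB &
      exists phi : V -> W, is_lie_isomorphism A brA B brB phi].

End LieAlgebras.

(* Complex matrices, with scalars restricted to R. *)
Definition realified_mx (R : realType) (k l : nat) : Type := 'M[R[i]]_(k, l).

Section RestrictionOfScalars.
Variables (R : realType) (k l : nat).

HB.instance Definition _ := GRing.Zmodule.on (realified_mx R k l).

Definition realified_scale (a : R) (M : realified_mx R k l) : realified_mx R k l :=
  a%:C *: (M : 'M[R[i]]_(k, l)).

Fact realified_scaleA (a b : R) (M : realified_mx R k l) :
  realified_scale a (realified_scale b M) = realified_scale (a * b) M.
Proof. by rewrite /realified_scale scalerA rmorphM. Qed.

Fact realified_scale1 : left_id 1 realified_scale.
Proof. by move=> M; rewrite /realified_scale rmorph1 scale1r. Qed.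

Fact realified_scaleDr : right_distributive realified_scale +%R.
Proof. by move=> a M N; exact: scalerDr. Qed.

Fact realified_scaleDl (M : realified_mx R k l) :
  {morph realified_scale^~ M : a b / a + b}.
Proof. by move=> a b; rewrite /realified_scale rmorphD; exact: scalerDl. Qed.

HB.instance Definition _ := GRing.Zmodule_isLmodule.Build R (realified_mx R k l)
  realified_scaleA realified_scale1 realified_scaleDr realified_scaleDl.

End RestrictionOfScalars.

Section IndefiniteUnitaryAlgebra.
Variables (R : realType) (N : nat).

(* s lists the eigenvalues of H with their algebraic multiplicities. *)
Definition has_signature (H : 'M[R[i]]_N) (p q : nat) : Prop :=
  exists s : seq R,
    [/\ char_poly H = \prod_(x <- s) ('X - (x%:C)%:P),
        count (fun x => 0 < x) s = p & count (fun x => x < 0) s = q].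

Definition unitary_lie_algebra (H : 'M[R[i]]_N) : set (realified_mx R N N) :=
  [set M : 'M[R[i]]_N | (H *m M)^t* + H *m M = 0].

Definition commutator (A B : realified_mx R N N) : realified_mx R N N :=
  (A : 'M[R[i]]_N) *m B - (B : 'M[R[i]]_N) *m A.

End IndefiniteUnitaryAlgebra.

Section SymmetryGroup.
Variable R : realType.

Definition expmx N (A : 'M[R]_N.+1) : 'M[R]_N.+1 :=
  limn (series (fun k => (k`!%:R)^-1 *: A ^+ k)).

Definition mx_of_rows k l (rows : seq (seq R)) : 'M[R]_(k, l) :=
  \matrix_(i < k, j < l) nth 0 (nth [::] rows i) j.

Definition hatmx (L : 'cV[R]_3) : 'M[R]_3 :=
  let L1 := L (inord 0) 0 in
  let L2 := L (inord 1) 0 in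
  let L3 := L (inord 2) 0 in
  mx_of_rows 3 3
    [:: [:: 0;    - L3; L2  ];
        [:: L3;   0;    - L1];
        [:: - L2; L1;   0   ]].

Definition isoc (L : 'cV[R]_3) : 'M[R]_4 :=
  block_mx (hatmx L) (- L) L^T (0 : 'M[R]_1).

Definition Kmx : 'M[R]_4 := mx_of_rows 4 4
  [:: [:: 0; 0; 0; -1];
      [:: 0; 0; 1; 0];
      [:: 0; -1; 0; 0];
      [:: 1; 0; 0; 0]].

Definition symmetry_group : set 'M[R]_4 :=
  [set S | exists (L : 'cV[R]_3) (tau : R),
     S = expmx (2^-1 *: (isoc L + tau *: Kmx))].

End SymmetryGroup.

Section PhaseSpace.
Variables (R : realType) (m : nat).

(* A point is (Q, P), where Q_i and P_i are the i-th columns of Q and P. *)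
Definition phase_space := ('M[R]_(4, m) * 'M[R]_(4, m))%type.

Definition dQ (i : 'I_m) (a : 'I_4) (f : phase_space -> R^o) : phase_space -> R^o :=
  'D_((delta_mx a i, 0) : phase_space) f.

Definition dP (i : 'I_m) (a : 'I_4) (f : phase_space -> R^o) : phase_space -> R^o :=
  'D_((0, delta_mx a i) : phase_space) f.

Definition poisson (f g : phase_space -> R^o) : phase_space -> R^o :=
  fun z => \sum_(i < m) \sum_(a < 4)
    (dQ i a f z * dP i a g z - dP i a f z * dQ i a g z).

Definition diagonal_action (S : 'M[R]_4) (z : phase_space) : phase_space :=
  (S *m z.1, S *m z.2).

Definition quadratic_form (f : phase_space -> R^o) : Prop :=
  exists b : {bilinear phase_space -> phase_space -> R^o}, forall z, f z = b z z.

Definition invariant_quadratic_forms : set (phase_space -> R^o) :=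
  [set f | quadratic_form f /\
     forall S, symmetry_group S -> forall z, f (diagonal_action S z) = f z].

End PhaseSpace.

(* Main.v *)
(* Stack the m vectors Q_i and the m vectors P_i as the columns of a 4 x 2m
   matrix X. An element of G is a right multiplication by a unit quaternion times
   some exp(t K), where K commutes with all of these and K^2 = -1; so the commutant
   of G is span(1, K), a copy of C. Hence the invariant quadratic forms are
   f_h(X) = tr(X A X^T) + tr(K X B X^T) with h = A + iB a Hermitian 2m x 2m
   matrix. The gradient of f_h is 2(XA + KXB), so {f_g, f_h} is the form of
   2(g J h - h J g) with J the standard symplectic matrix, and h |-> -2 J^-1 h
   turns this bracket into the commutator of matrices that are skew for iJ. By
   the spectral theorem a Hermitian H of signature (m, m) is congruent to iJ. *)

Require Import Defs.
From HB Require Import structures.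
From mathcomp Require Import all_boot all_order all_algebra.
From mathcomp Require Import spectral sesquilinear complex.
From mathcomp Require Import all_classical all_reals all_analysis.
From mathcomp Require Import perm.
From mathcomp Require Import ring lra.

Set Implicit Arguments.
Unset Strict Implicit.
Unset Printing Implicit Defensive.

Import Order.TTheory GRing.Theory Num.Theory.
Import numFieldNormedType.Exports.
Local Open Scope ring_scope.
Local Open Scope complex_scope.

(** * Sylvester inertia: Hermitian matrices of signature (m, m) are congruent to iJ *)

Section Inertia.
Context {R : realType}.
Local Open Scope sesquilinear_scope.
Local Notation C := R[i].
Implicit Types (m n : nat).

Definition symplectic_mx {F : pzRingType} m : 'M[F]_(m + m) :=
  block_mx 0 1%:M (- 1%:M) 0.

Lemma symplectic_mx_sqr {F : pzRingType} m :
  symplectic_mx m *m symplectic_mx m = - 1%:M :> 'M[F]_(m + m).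
Proof.
rewrite /symplectic_mx mulmx_block !(mul0mx, mulmx0, mulmx1, mul1mx, add0r, addr0).
by rewrite [RHS](congr1 -%R (scalar_mx_block _ _ _)) opp_block_mx oppr0.
Qed.

(* A separate constant, so that unification never has to compare two paths to
   the ring structure of [R[i]] by unfolding them. *)
Definition csymplectic_mx m : 'M[C]_(m + m) := symplectic_mx m.

Lemma csymplectic_mx_sqr m : csymplectic_mx m *m csymplectic_mx m = - 1%:M.
Proof. exact: symplectic_mx_sqr. Qed.

Lemma trmxC_mul m n p (A : 'M[C]_(m, n)) (B : 'M[C]_(n, p)) :
  (A *m B)^t* = B^t* *m A^t*.
Proof. by rewrite trmx_mul map_mxM. Qed.

(** The m positive and m negative entries already fill all m + m places, so no entry vanishes.
    Listing the positive indices first and the others after them gives the permutation. *)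
Lemma perm_sorting_signs m (d : 'rV[R]_(m + m)) :
  count (fun x => 0 < x) [seq d 0 i | i <- enum 'I_(m + m)] = m ->
  count (fun x => x < 0) [seq d 0 i | i <- enum 'I_(m + m)] = m ->
  exists s : 'S_(m + m),
    (forall i, 0 < d 0 (s (lshift m i))) /\ (forall i, d 0 (s (rshift m i)) < 0).
Proof.
move=> pos neg; pose e := enum 'I_(m + m).
pose t := [seq i <- e | 0 < d 0 i] ++ [seq i <- e | ~~ (0 < d 0 i)].
have tperm : perm_eq t e by exact/permPl/perm_filterC.
have st : size t == (m + m)%N by rewrite (perm_size tperm) size_enum_ord.
have sp : size [seq i <- e | 0 < d 0 i] = m by rewrite size_filter; move: pos; rewrite count_map.
have sn : size [seq i <- e | d 0 i < 0] = m by rewrite size_filter; move: neg; rewrite count_map.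
have tneg : [seq i <- e | d 0 i < 0] = [seq i <- e | ~~ (0 < d 0 i)].
  have sub : subseq [seq i <- e | d 0 i < 0] [seq i <- e | ~~ (0 < d 0 i)].
    have -> : [seq i <- e | d 0 i < 0] =
        [seq i <- [seq i <- e | ~~ (0 < d 0 i)] | d 0 i < 0].
      rewrite -filter_predI; apply: eq_filter => i /=.
      by case: ltgtP.
    exact: filter_subseq.
  apply/eqP; rewrite -(size_subseq_leqif sub) sn eq_sym.
  by move: st; rewrite size_cat sp eqn_add2l.
have ti : injective (fun i : 'I_(m + m) => tnth (Tuple st) i).
  by apply/tuple_uniqP; rewrite /= (perm_uniq tperm) enum_uniq.
exists (perm ti); split => i; rewrite permE (tnth_nth (rshift m i)) /= nth_cat sp.
  rewrite ltn_ord; have := mem_nth (rshift m i) (_ : i < size [seq i <- e | (0 < d 0 i)%R])%N.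
  by rewrite sp mem_filter => /(_ (ltn_ord i))/andP[].
rewrite ltnNge leq_addr /= addKn -tneg.
have := mem_nth (rshift m i) (_ : i < size [seq i <- e | (d 0 i < 0)%R])%N.
by rewrite sn mem_filter => /(_ (ltn_ord i))/andP[].
Qed.

(** Scaling the i-th coordinate by the inverse square root of [|d 0 i|] leaves only the sign of each
    entry. *)
Lemma diag_congr_signature m (d : 'rV[R]_(m + m)) :
  (forall i, 0 < d 0 (lshift m i)) -> (forall i, d 0 (rshift m i) < 0) ->
  exists2 P : 'M[C]_(m + m), P \in unitmx &
    P^t* *m diag_mx (map_mx (real_complex R) d) *m P = block_mx 1%:M 0 0 (- 1%:M).
Proof.
move=> pos neg; pose c : 'rV[C]_(m + m) := \row_i ((Num.sqrt `|d 0 i|)^-1)%:C.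
have d0 i : d 0 i != 0.
  by case: (split_ordP i) => j ->; [rewrite gt_eqF | rewrite lt_eqF].
exists (diag_mx c).
  rewrite unitmxE det_diag unitfE; apply/prodf_neq0 => i _; rewrite mxE.
  by rewrite fmorph_eq0 invr_eq0 sqrtr_eq0 -ltNge normr_gt0.
rewrite tr_diag_mx map_diag_mx !mulmx_diag.
have -> : \row_j ((\row_k (map_mx Num.conj c 0 k * map_mx (real_complex R) d 0 k)) 0 j
    * c 0 j) = \row_j (Num.sg (d 0 j))%:C.
  apply/rowP => i; rewrite !mxE -[Num.conj _]/(conjc _) conjc_real -!rmorphM /=.
  rewrite mulrAC -invfM -expr2 sqr_sqrtr ?normr_ge0 //.
  by rewrite {2}(numEsg (d 0 i)) mulrCA mulVf ?mulr1 // normr_eq0.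
apply/matrixP => i j; rewrite [LHS]mxE [X in X *+ _]mxE.
case: (split_ordP i) => i' ->; case: (split_ordP j) => j' ->;
  rewrite ?block_mxEul ?block_mxEur ?block_mxEdl ?block_mxEdr !mxE.
- by rewrite eq_lshift gtr0_sg // rmorph1.
- by rewrite eq_lrshift.
- by rewrite eq_rlshift.
- by rewrite eq_rshift ltr0_sg // rmorphN1 mulNrn.
Qed.

Lemma block_mx_signature {F : pzRingType} m (A : 'M[F]_m) :
  block_mx 1%:M 1%:M (- A) A *m block_mx 1%:M 0 0 (- 1%:M) *m block_mx 1%:M A 1%:M (- A) =
  block_mx 0 (A + A) (- (A + A)) 0.
Proof.
rewrite !mulmx_block !(mulmx1, mul1mx, mulmx0, mul0mx, addr0, add0r, mulmxN, mulNmx, opprK).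
by rewrite !addNr subrr opprD.
Qed.

Lemma signature_congr_symplectic m :
  exists2 P : 'M[C]_(m + m), P \in unitmx &
    P^t* *m block_mx 1%:M 0 0 (- 1%:M) *m P = 'i *: csymplectic_mx m.
Proof.
(* [c] is i/2: being purely imaginary it changes sign under conjugation, so [P^t*] has the shape
   required by [block_mx_signature], and its double is i. *)
have [c cJ cc] : exists2 c : C, Num.conj c = - c & c + c = 'i.
  exists (0 +i* 2^-1); apply/eqP; rewrite eq_complex /= ?oppr0 ?addr0 !eqxx //=.
  by rewrite -mulr2n -[2^-1]mul1r -mulrnAl divff ?pnatr_eq0.
pose P : 'M[C]_(m + m) := block_mx 1%:M c%:M 1%:M (- c%:M).
have PP : P^t* *m block_mx 1%:M 0 0 (- 1%:M) *m P = 'i *: csymplectic_mx m.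
  have cmxJ : map_mx Num.conj (c%:M : 'M[C]_m) = - c%:M.
    by rewrite map_scalar_mx /= cJ raddfN.
  have cmxD : c%:M + c%:M = 'i *: 1%:M :> 'M[C]_m.
    by rewrite -raddfD /= cc scale_scalar_mx mulr1.
  rewrite /P tr_block_mx map_block_mx linearN /= map_mxN !tr_scalar_mx cmxJ map_mx1.
  by rewrite [- - _]opprK block_mx_signature /csymplectic_mx /symplectic_mx scale_block_mx scaler0 scalerN cmxD.
exists P => //.
(* iJ is its own inverse, so the congruence itself exhibits a left inverse of [P]. *)
have JJ : ('i *: csymplectic_mx m) *m ('i *: csymplectic_mx m) = 1%:M :> 'M[C]_(m + m).
  by rewrite -scalemxAl -scalemxAr scalerA -expr2 sqr_i scaleN1r csymplectic_mx_sqr opprK.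
have : ('i *: csymplectic_mx m *m (P^t* *m block_mx 1%:M 0 0 (- 1%:M))) *m P = 1%:M.
  by rewrite -mulmxA PP JJ.
by case/mulmx1_unit.
Qed.

Lemma char_poly_conj {F : fieldType} n (U A : 'M[F]_n) :
  U \in unitmx -> char_poly (invmx U *m A *m U) = char_poly A.
Proof.
move=> Uunit; rewrite /char_poly /char_poly_mx !map_mxM /=.
set V := map_mx polyC U; set V' := map_mx polyC (invmx U).
have VV : V' *m V = 1%:M by rewrite -map_mxM mulVmx // map_mx1.
have -> : 'X%:M - V' *m map_mx polyC A *m V = V' *m ('X%:M - map_mx polyC A) *m V.
  by rewrite mulmxBr mulmxBl scalar_mxC -[X in _ = X - _]mulmxA VV mulmx1.
by rewrite !det_mulmx mulrAC -det_mulmx VV det1 mul1r.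
Qed.

Lemma perm_mx_diag {F : comNzRingType} n (s : 'S_n) (d : 'rV[F]_n) :
  (perm_mx s *m diag_mx d *m (perm_mx s)^T) = diag_mx (\row_i d 0 (s i)).
Proof.
rewrite tr_perm_mx -row_permE -col_permE; apply/matrixP => i j.
by rewrite !mxE (inj_eq perm_inj).
Qed.

Lemma congr_mulmx {F : fieldType} n (U D S S' Q Q' W W' : 'M[F]_n) : U \in unitmx ->
  W' *m (Q' *m (S *m U)) *m (invmx U *m D *m U) *m (invmx U *m S' *m Q *m W) =
  W' *m (Q' *m (S *m D *m S') *m Q) *m W.
Proof. by move=> Uunit; rewrite -!mulmxA !mulKVmx. Qed.

(** Four congruences are composed: unitary diagonalisation, sorting the eigenvalues by sign,
    rescaling them to 1 and -1, and passing from diag(1, -1) to iJ. *)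
Lemma hermitian_congr_symplectic m (H : 'M[C]_(m + m)) :
  H \is hermsymmx -> has_signature H m m ->
  exists2 P : 'M[C]_(m + m), P \in unitmx & P^t* *m H *m P = 'i *: csymplectic_mx m.
Proof.
move=> Hherm [s [charH spos sneg]].
have /orthomx_spectralP HE := hermitian_normalmx Hherm.
have /mxOverP Dreal := hermitian_spectral_diag_real Hherm.
set U := spectralmx H in HE; set D := spectral_diag H in HE Dreal.
have Uunit : U \in unitmx by exact: spectral_unit.
pose d : 'rV[R]_(m + m) := map_mx (@complex.Re R) D.
have DE : D = map_mx (real_complex R) d.
  by apply/rowP => i; rewrite !mxE RRe_real // Dreal.
have charD : char_poly H = \prod_(x <- [seq (d 0 i)%:C | i <- enum 'I_(m + m)]) ('X - x%:P).
  have -> : char_poly H = char_poly (diag_mx D).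
    by rewrite {1}HE char_poly_conj.
  rewrite char_poly_trig ?diag_mx_is_trig // big_map big_enum /=.
  by apply: eq_bigr => i _; rewrite DE !mxE eqxx.
(* Both lists are the roots of the same split polynomial, so the sign counts of [s] carry over to
   the spectral diagonal. *)
have sd : perm_eq s [seq d 0 i | i <- enum 'I_(m + m)].
  apply: (perm_map_inj (@complexI R)); apply: prod_XsubC_eq.
  by rewrite -map_comp big_map -charH charD !big_map.
have [p [ppos pneg]] := perm_sorting_signs
  (etrans (esym (seq.permP sd (fun x => 0 < x))) spos)
  (etrans (esym (seq.permP sd (fun x => x < 0))) sneg).
pose d' := \row_i d 0 (p i).
have [||Q Qunit QE] := @diag_congr_signature m d'.
- by move=> i; rewrite mxE.
- by move=> i; rewrite mxE.
have [W Wunit WE] := signature_congr_symplectic m.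
exists (invmx U *m (perm_mx p)^T *m Q *m W).
  by rewrite !unitmx_mul unitmx_inv Uunit unitmx_tr unitmx_perm Qunit.
rewrite !trmxC_mul trmxK map_perm_mx.
rewrite {1}invmx_unitary ?spectral_unitarymx // trmxCK.
have dD : map_mx (real_complex R) d' = \row_i D 0 (p i).
  by apply/rowP => i; rewrite DE !mxE.
by rewrite {1}HE congr_mulmx // perm_mx_diag -dD QE WE.
Qed.

End Inertia.

(** * Transport of a Lie algebra structure along a bijection *)

Section LieTransport.
Context {R : realType}.
Local Open Scope classical_set_scope.

(** Only the source [B] has to be known as a Lie algebra: every element of [A] is an image under
    [psi], so closure, bilinearity and the Jacobi identity are inherited. The Poisson bracket gets
    its Lie axioms this way. *)
Lemma lie_isomorphic_of_bij (V W : lmodType R) (A : set V) (brA : V -> V -> V)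
    (B : set W) (brB : W -> W -> W) (psi : W -> V) :
  is_lie_algebra B brB -> set_bij B A psi ->
  (forall a x y, B x -> B y -> psi (a *: x + y) = a *: psi x + psi y) ->
  (forall x y, B x -> B y -> psi (brB x y) = brA (psi x) (psi y)) ->
  lie_isomorphic A brA B brB.
Proof.
move=> LB [funAB injB surjB] lin hom.
have [B0 Blin Bbr brDl brDr alt jac] := LB.
have onto z : A z -> exists2 x, B x & z = psi x by case/surjB => x Bx <-; exists x.
have psi0 : psi 0 = 0.
  by have := lin 1 0 0 B0 B0; rewrite !scale1r addr0 => /(canLR (addrK _)) <-; rewrite subrr.
have psiD x y : B x -> B y -> psi (x + y) = psi x + psi y.
  by move=> Bx By; have := lin 1 x y Bx By; rewrite !scale1r.
have BD x y : B x -> B y -> B (x + y).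
  by move=> Bx By; have := Blin 1 x y Bx By; rewrite !scale1r.
have LA : is_lie_algebra A brA.
  split.
  - by rewrite -psi0; exact: funAB.
  - by move=> a _ _ /onto[x Bx ->] /onto[y By ->]; rewrite -lin //; apply/funAB/Blin.
  - by move=> _ _ /onto[x Bx ->] /onto[y By ->]; rewrite -hom //; apply/funAB/Bbr.
  - move=> a _ _ _ /onto[x Bx ->] /onto[y By ->] /onto[z Bz ->].
    have Bl := Blin a _ _ Bx By; have Bxz := Bbr _ _ Bx Bz; have Byz := Bbr _ _ By Bz.
    by rewrite -lin // -!hom // brDl // lin.
  - move=> a _ _ _ /onto[x Bx ->] /onto[y By ->] /onto[z Bz ->].
    have Bl := Blin a _ _ By Bz; have Bxy := Bbr _ _ Bx By; have Bxz := Bbr _ _ Bx Bz.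
    by rewrite -lin // -!hom // brDr // lin.
  - by move=> _ /onto[x Bx ->]; rewrite -hom // alt // psi0.
  - move=> _ _ _ /onto[x Bx ->] /onto[y By ->] /onto[z Bz ->].
    have Byz := Bbr _ _ By Bz; have Bzx := Bbr _ _ Bz Bx; have Bxy := Bbr _ _ Bx By.
    have B1 := Bbr _ _ Bx Byz; have B2 := Bbr _ _ By Bzx; have B3 := Bbr _ _ Bz Bxy.
    by rewrite -!hom // -!psiD ?jac //; exact: BD.
(* [phi] inverts [psi] by choice; the default value 0 is taken only outside the image of [B]. *)
split => //; pose phi z := xget 0 [set x | B x /\ psi x = z].
have phiP x : B x -> phi (psi x) = x.
  move=> Bx; rewrite /phi; case: xgetP => [y _ [By yx]|/(_ x)]; last by case.
  by apply: injB; rewrite ?inE.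
exists phi; split.
- split.
  + by move=> _ /onto[x Bx ->]; rewrite phiP.
  + by move=> z z'; rewrite !inE => /onto[x Bx ->] /onto[y By ->]; rewrite !phiP // => ->.
  + by move=> x Bx; exists (psi x); [exact: funAB | exact: phiP].
- move=> a _ _ /onto[x Bx ->] /onto[y By ->].
  by rewrite -lin // !phiP //; exact: Blin.
- move=> _ _ /onto[x Bx ->] /onto[y By ->].
  by rewrite -hom // !phiP //; exact: Bbr.
Qed.

End LieTransport.

(** * The unitary Lie algebra of a Hermitian form *)

Section UnitaryLieAlgebra.
Context {R : realType} {N : nat}.
Variable H : 'M[R[i]]_N.
Hypothesis H_hermitian : H \is hermsymmx.
Local Open Scope sesquilinear_scope.

Lemma hermitian_trmxC (A : 'M[R[i]]_N) : (A \is hermsymmx) = (A^t* == A).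
Proof. by rewrite qualifE /= expr0 scale1r eq_sym. Qed.

Lemma trmxCD k l (A B : 'M[R[i]]_(k, l)) : (A + B)^t* = A^t* + B^t*.
Proof. by rewrite linearD map_mxD. Qed.

Lemma trmxCB k l (A B : 'M[R[i]]_(k, l)) : (A - B)^t* = A^t* - B^t*.
Proof. by rewrite linearB map_mxB. Qed.

Lemma trmxCZ k l c (A : 'M[R[i]]_(k, l)) : (c *: A)^t* = conjc c *: A^t*.
Proof. by rewrite linearZ /= map_mxZ. Qed.

Lemma realified_scaleE a (x : realified_mx R N N) : a *: x = a%:C *: (x : 'M[R[i]]_N).
Proof. by []. Qed.

Lemma unitary_is_lie_algebra :
  is_lie_algebra (unitary_lie_algebra H) (@commutator R N).
Proof.
have HJ : H^t* = H by apply/eqP; rewrite -hermitian_trmxC.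
(* As [H] is Hermitian, membership lets [M^t*] be moved past [H] at the cost of a sign; two such
   moves give closure under the commutator. *)
have UP (M : 'M[R[i]]_N) : unitary_lie_algebra H M <-> M^t* *m H = - (H *m M).
  rewrite /unitary_lie_algebra /= trmxC_mul HJ.
  by split => [/eqP|->]; rewrite ?addr_eq0 ?addNr// => /eqP.
split.
- by apply/UP; rewrite trmx0 map_mx0 mul0mx mulmx0 oppr0.
- move=> a x y /UP Mx /UP My; apply/UP.
  rewrite trmxCD realified_scaleE trmxCZ conjc_real mulmxDl mulmxDr.
  by rewrite -scalemxAl -scalemxAr Mx My scalerN opprD.
- move=> x y /UP Mx /UP My; apply/UP.
  rewrite /commutator trmxCB !trmxC_mul mulmxBl -!mulmxA Mx My !mulmxN !mulmxA Mx My.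
  by rewrite !mulNmx !opprK mulmxBr opprB !mulmxA.
- move=> a x y z _ _ _; rewrite /commutator.
  rewrite !realified_scaleE mulmxDl mulmxDr -scalemxAl -scalemxAr.
  by rewrite scalerBr opprD addrACA.
- move=> a x y z _ _ _; rewrite /commutator.
  rewrite !realified_scaleE mulmxDl mulmxDr -scalemxAl -scalemxAr.
  by rewrite scalerBr opprD addrACA.
- by move=> x _; rewrite /commutator subrr.
- move=> x y z _ _ _; rewrite /commutator !(mulmxBl, mulmxBr) !mulmxA.
  rewrite !opprB.
  (* After expansion each of the six triple products of x, y, z occurs once with each sign. *)
  have cancel (a b c d e f : 'M[R[i]]_N) :
      a - b + (c - d) + (d - e + (b - f)) + (f - c + (e - a)) = 0.
    by apply/matrixP => i j; rewrite !mxE; ring.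
  exact: cancel.
Qed.
End UnitaryLieAlgebra.

(** * Exponentials generated by two commuting square roots of -1 *)

Section CommutingComplexStructures.
Context {R : realFieldType} {V : algType R}.
(* [h] is 1/2; kept abstract because with the literal [2^-1] the scalar structures
   introduced by [scalerAl] no longer unify with those of [scalerA]. *)
Variables (h : R) (A B : V).
Hypotheses (h2 : h *+ 2 = 1) (AA : A * A = -1) (BB : B * B = -1) (AB : GRing.comm A B).

Let p : V := h *: (1 + A * B).
Let q : V := h *: (1 - A * B).

Let EE : A * B * (A * B) = 1.
Proof. by rewrite mulrA -[A * B * A]mulrA -AB mulrA AA mulN1r mulNr BB opprK. Qed.

Let half : h * h * 2 = h. Proof. by rewrite -mulrA mulr_natr h2 mulr1. Qed.

Let AE : GRing.comm A (A * B). Proof. by apply: commrM. Qed.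

Lemma comm_idempotent : GRing.comm A (h *: (1 + A * B)).
Proof. by rewrite /GRing.comm -scalerAl -scalerAr (commrD (commr1 A) AE). Qed.

Lemma comm_coidempotent : GRing.comm A (h *: (1 - A * B)).
Proof. by rewrite /GRing.comm -scalerAl -scalerAr (commrB (commr1 A) AE). Qed.

Let pp : p * p = p.
Proof.
rewrite /p -scalerAl -scalerAr scalerA mulrDl mul1r mulrDr mulr1 EE [A * B + 1]addrC.
by rewrite -mulr2n -scaler_nat scalerA half.
Qed.

Let qq : q * q = q.
Proof.
rewrite /q -scalerAl -scalerAr scalerA mulrBl mul1r mulrBr mulr1 EE.
by rewrite [- (_ - _)]opprB -mulr2n -scaler_nat scalerA half.
Qed.

Let pq : p * q = 0.
Proof.
rewrite /p /q -scalerAl -scalerAr mulrDl mul1r mulrBr mulr1 EE.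
by rewrite addrA subrK subrr !scaler0.
Qed.

Let qp : q * p = 0.
Proof.
rewrite /p /q -scalerAl -scalerAr mulrBl mul1r mulrDr mulr1 EE.
by rewrite opprD addrA addrK subrr !scaler0.
Qed.

Lemma idempotentD : h *: (1 + A * B) + h *: (1 - A * B) = 1.
Proof.
by rewrite -scalerDr addrACA subrr addr0 -mulr2n -scaler_nat scalerA mulr_natr h2 scale1r.
Qed.

Lemma idempotentB : h *: (1 - A * B) - h *: (1 + A * B) = - (A * B).
Proof.
rewrite -scalerBr opprD addrACA subrr add0r -opprD -mulr2n scalerN -scaler_nat.
by rewrite scalerA mulr_natr h2 scale1r.
Qed.

(* [p] and [q] are the complementary idempotents of the involution [A B]; they
   replace [B] by [-A] and [A] respectively. *)
Lemma biquaternion_expr l t k :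
  (h *: (l *: A + t *: B)) ^+ k =
    ((h * (l - t)) *: A) ^+ k * (h *: (1 + A * B)) +
    ((h * (l + t)) *: A) ^+ k * (h *: (1 - A * B)).
Proof.
rewrite -/p -/q; set a := h * (l - t); set b := h * (l + t).
(* Since A(AB) = -B, [A * p] is (A - B)/2 and [A * q] is (A + B)/2, which yields the coefficients
   [a] and [b]. *)
have XE : h *: (l *: A + t *: B) = a *: A * p + b *: A * q.
  rewrite /p /q -!(scalerAl, scalerAr) mulrDr mulrBr mulr1 mulrA AA mulN1r opprK.
  rewrite !(scalerDr, scalerN, scalerA).
  rewrite [RHS]addrACA -scalerDl [- _ + _]addrC -scalerBl.
  by congr (_ *: _ + _ *: _); rewrite -{1}half /a /b; ring.
elim: k => [|k IH]; first by rewrite !expr0 !mul1r idempotentD.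
rewrite exprSr IH XE.
have swap u v (r s : V) : GRing.comm A r ->
    (u *: A) ^+ k * r * (v *: A * s) = (u *: A) ^+ k * (v *: A) * (r * s).
  by move=> Ar; rewrite -!mulrA; congr (_ * _); rewrite !mulrA -scalerAr -[r * A]Ar scalerAl.
have Ap : GRing.comm A p := comm_idempotent; have Aq : GRing.comm A q := comm_coidempotent.
by rewrite mulrDr !mulrDl !swap // pp qq pq qp !mulr0 !addr0 add0r -!exprSr.
Qed.

(** The closed form of the exponential: rotations in the complex structure [A] by independent angles
    on the ranges of the two idempotents. *)
Definition double_rotation (c s c' s' : R) : V :=
  (c *: 1 + s *: A) * (h *: (1 + A * B)) + (c' *: 1 + s' *: A) * (h *: (1 - A * B)).

Let rotE c s (r : V) : r * r = r -> GRing.comm A r -> c ^+ 2 + s ^+ 2 = 1 ->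
  (c *: 1 + (- s) *: A) * r * ((c *: 1 + s *: A) * r) = r.
Proof.
move=> rr Ar cs.
have Er : r * (c *: 1 + s *: A) = (c *: 1 + s *: A) * r.
  by rewrite mulrDl mulrDr -!scalerAl -!scalerAr mulr1 mul1r Ar.
rewrite -mulrA [r * _]mulrA Er -[_ * r * r]mulrA rr mulrA.
rewrite mulrDl !mulrDr -!scalerAl -!scalerAr !mul1r mulr1 AA !scalerN !scalerA.
rewrite !mulNr !scaleNr opprK [- _ + _]addrC addrACA [s * c]mulrC subrr addr0.
by rewrite -scalerDl -!expr2 cs scale1r mul1r.
Qed.

(** Negating the sines reverses both angles. The cross terms vanish because the idempotents
    annihilate each other, and on each range (c - sA)(c + sA) is c^2 + s^2. *)
Lemma double_rotationK c s c' s' : c ^+ 2 + s ^+ 2 = 1 -> c' ^+ 2 + s' ^+ 2 = 1 ->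
  double_rotation c (- s) c' (- s') * double_rotation c s c' s' = 1.
Proof.
have Ap : GRing.comm A p := comm_idempotent; have Aq : GRing.comm A q := comm_coidempotent.
move=> cs cs'; rewrite /double_rotation -/p -/q mulrDl !mulrDr !rotE //.
have cross u v (r r' : V) : r * r' = 0 -> GRing.comm A r' ->
    u * r * ((v.1 *: 1 + v.2 *: A) * r') = 0.
  move=> rr Ar.
  have -> : (v.1 *: 1 + v.2 *: A) * r' = r' * (v.1 *: 1 + v.2 *: A).
    by rewrite mulrDl mulrDr -!scalerAl -!scalerAr mulr1 mul1r Ar.
  by rewrite mulrA -[u * r * r']mulrA rr mulr0 mul0r.
by rewrite (cross _ (c', s')) // (cross _ (c, s)) // addr0 add0r idempotentD.
Qed.

Lemma double_rotation_comm c s c' s' : GRing.comm (double_rotation c s c' s') B.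
Proof.
have BA : GRing.comm B A by [].
have BE : GRing.comm B (A * B) by apply: commrM.
have BZ a x : GRing.comm B x -> GRing.comm B (a *: x).
  by move=> Bx; rewrite /GRing.comm -scalerAl -scalerAr Bx.
by apply/commr_sym/commrD; apply: commrM; do ?[apply: commrB|apply: commrD|apply: BZ];
  rewrite // ; exact: commr1.
Qed.

End CommutingComplexStructures.

(** * Closed form and basic elements of the symmetry group *)

Section SymmetryGroup.
Context {R : realType}.
Local Open Scope classical_set_scope.
Local Notation M4 := 'M[R]_4.
Local Notation K := (Kmx R).

Lemma isocE (L : 'cV[R]_3) (x := L (inord 0) 0) (y := L (inord 1) 0) (z := L (inord 2) 0) :
  isoc L = mx_of_rows 4 4
    [:: [:: 0; - z; y; - x]; [:: z; 0; - x; - y]; [:: - y; x; 0; - z]; [:: x; y; z; 0]].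
Proof.
have inordE (k : 'I_3) (i : nat) : nat_of_ord k = i -> k = inord i.
  by move=> <-; rewrite inord_val.
apply/matrixP => i j.
case: (@split_ordP 3 1 i) => i' ->; case: (@split_ordP 3 1 j) => j' ->.
- rewrite /isoc (@block_mxEul R 3 1 3 1) !mxE /=.
  by case: i' => -[|[|[|//]]] ?; case: j' => -[|[|[|//]]] ?.
- rewrite /isoc (@block_mxEur R 3 1 3 1) !mxE ord1 /= /x /y /z.
  by case: i' => -[|[|[|//]]] ?; rewrite /=; congr (- L _ _); apply: inordE.
- rewrite /isoc (@block_mxEdl R 3 1 3 1) !mxE ord1 /= /x /y /z.
  by case: j' => -[|[|[|//]]] ?; rewrite /=; congr (L _ _); apply: inordE.
- by rewrite /isoc (@block_mxEdr R 3 1 3 1) !mxE !ord1.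
Qed.

Lemma isocZ a L : isoc (a *: L) = a *: isoc L :> M4.
Proof.
rewrite !isocE; apply/matrixP => -[[|[|[|[|//]]]] ?] [[|[|[|[|//]]]] ?];
  by rewrite !mxE /= ?mxE; ring.
Qed.

Lemma Kmx_sqr : K * K = -1.
Proof.
apply/matrixP => -[[|[|[|[|//]]]] ?] [[|[|[|[|//]]]] ?];
  by rewrite !mxE !big_ord_recl big_ord0 !mxE /=; ring.
Qed.

Lemma tr_Kmx : K^T = - K.
Proof.
by apply/matrixP => -[[|[|[|[|//]]]] ?] [[|[|[|[|//]]]] ?]; rewrite !mxE /= ?oppr0 ?opprK.
Qed.

Lemma tr_isoc L : (isoc L)^T = - isoc L :> M4.
Proof.
rewrite isocE.
by apply/matrixP => -[[|[|[|[|//]]]] ?] [[|[|[|[|//]]]] ?]; rewrite !mxE /= ?oppr0 ?opprK.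
Qed.

Lemma isoc_sqr (L : 'cV[R]_3) :
  isoc L * isoc L = (- \sum_i (L i 0) ^+ 2)%:M :> M4.
Proof.
have -> : \sum_i (L i 0) ^+ 2 =
   (L (inord 0) 0) ^+ 2 + (L (inord 1) 0) ^+ 2 + (L (inord 2) 0) ^+ 2.
  rewrite !big_ord_recl big_ord0 addr0 addrA.
  by congr (L _ _ ^+ 2 + L _ _ ^+ 2 + L _ _ ^+ 2); apply/val_inj; rewrite /= inordK.
rewrite isocE; apply/matrixP => -[[|[|[|[|//]]]] ?] [[|[|[|[|//]]]] ?];
  by rewrite !mxE !big_ord_recl big_ord0 !mxE /=; ring.
Qed.

Lemma comm_isoc_Kmx L : GRing.comm (isoc L : M4) K.
Proof.
rewrite isocE /GRing.comm; apply/matrixP => -[[|[|[|[|//]]]] ?] [[|[|[|[|//]]]] ?];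
  by rewrite !mxE !big_ord_recl !big_ord0 !mxE /=; ring.
Qed.

(** The coefficients are shaped like [cos_coeff] and [sin_coeff], so that the exponential series
    splits into the cosine and sine series. *)
Lemma unit_sqr_expr (A : M4) k : A * A = -1 ->
  A ^+ k = ((~~ odd k)%:R * (-1) ^+ k./2) *: 1 + ((odd k)%:R * (-1) ^+ k.-1./2) *: A.
Proof.
move=> AA; elim: k => [|k IH]; first by rewrite expr0 /= mulr1 mul0r scale0r addr0 scale1r.
rewrite exprS {}IH mulrDr -!scalerAr AA mulr1 /= uphalf_half addrC scalerN -scaleNr.
case: (boolP (odd k)) => ok /=; rewrite !(mul0r, mul1r, oppr0, scale0r, add0r, addr0, add0n) //.
case: k ok => // k /= ok.
by rewrite uphalf_half (negbTE ok) add0n add1n exprS mulN1r.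
Qed.

Lemma cvg_series_expmx (A p : M4) (a : R) : A * A = -1 ->
  series (fun k => (k`!%:R)^-1 *: ((a *: A) ^+ k * p)) @ \oo -->
    ((cos a *: 1 + sin a *: A) * p : M4).
Proof.
move=> AA.
have -> : series (fun k => (k`!%:R)^-1 *: ((a *: A) ^+ k * p)) =
    (fun n => series (cos_coeff a) n *: p + series (sin_coeff a) n *: (A * p)).
  apply/funext => n; rewrite /series /= !scaler_suml -big_split; apply: eq_bigr => k _ /=.
  rewrite exprZn unit_sqr_expr // -scalerAl mulrDl -!scalerAl mul1r.
  rewrite !(scalerDr, scalerA) /cos_coeff /sin_coeff /= -exprnP.
  by congr (_ *: _ + _ *: _); ring.
rewrite mulrDl -!scalerAl mul1r.
apply: cvgD; apply: cvgZr_tmp; rewrite unlock.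
- exact: is_cvg_series_cos_coeff.
- exact: is_cvg_series_sin_coeff.
Qed.

(** The idempotents of the involution [A * K] split the exponential series into two, and Euler's
    formula sums each of them. *)
Lemma expmx_symmetry (A : M4) (l t : R) : A * A = -1 -> GRing.comm A K ->
  expmx (2^-1 *: (l *: A + t *: K)) =
    double_rotation 2^-1 A K (cos (2^-1 * (l - t))) (sin (2^-1 * (l - t)))
                             (cos (2^-1 * (l + t))) (sin (2^-1 * (l + t))).
Proof.
move=> AA AK; rewrite /expmx; have h2 : 2^-1 *+ 2 = 1 :> R by field.
apply: cvg_lim; first exact: norm_hausdorff.
have -> : series (fun k => (k`!%:R)^-1 *: (2^-1 *: (l *: A + t *: K)) ^+ k) =
    series (fun k => (k`!%:R)^-1 *:
      (((2^-1 * (l - t)) *: A) ^+ k * (2^-1 *: (1 + A * K)))) \+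
    series (fun k => (k`!%:R)^-1 *:
      (((2^-1 * (l + t)) *: A) ^+ k * (2^-1 *: (1 - A * K)))).
  apply/funext => n; rewrite /series /= -big_split; apply: eq_bigr => k _.
  by rewrite (biquaternion_expr h2 AA Kmx_sqr AK) scalerDr.
by apply: cvgD; exact: cvg_series_expmx.
Qed.

Lemma delta_unit (k : 'I_3) : \sum_i ((delta_mx k 0 : 'cV[R]_3) i 0) ^+ 2 = 1.
Proof.
rewrite (bigD1 k) //= big1 ?mxE ?eqxx ?expr1n ?addr0 // => i ik.
by rewrite mxE (negbTE ik) expr0n.
Qed.

(** For a unit vector [u], [isoc u] squares to -1, so every generator takes the form treated by
    [expmx_symmetry]. *)
Lemma isoc_unit_decomposition (L : 'cV[R]_3) :
  exists l u, L = l *: u /\ \sum_i (u i 0) ^+ 2 = 1.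
Proof.
have [L0|L0] := eqVneq L 0.
  by exists 0, (delta_mx 0 0); rewrite L0 scale0r delta_unit.
pose s := \sum_i (L i 0) ^+ 2.
have s0 : 0 < s.
  rewrite lt_def sumr_ge0 ?andbT => [|i _]; last exact: sqr_ge0.
  apply: contraNneq L0 => s0; apply/eqP/colP => i; rewrite mxE.
  by apply/eqP; rewrite -sqrf_eq0 (psumr_eq0P _ s0) // => j _; exact: sqr_ge0.
exists (Num.sqrt s), ((Num.sqrt s)^-1 *: L); split.
  by rewrite scalerA divff ?scale1r // gt_eqF // sqrtr_gt0.
under eq_bigr do rewrite mxE exprMn.
by rewrite -mulr_sumr exprVn sqr_sqrtr ?ltW // mulVf // gt_eqF.
Qed.

Let isoc_unit (u : 'cV[R]_3) : \sum_i (u i 0) ^+ 2 = 1 -> isoc u * isoc u = -1 :> M4.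
Proof. by move=> u1; rewrite isoc_sqr u1 raddfN. Qed.

Let half2 : 2^-1 *+ 2 = 1 :> R. Proof. by field. Qed.

Lemma symmetry_group_commute (S : M4) : symmetry_group S -> S *m K = K *m S.
Proof.
move=> [L [t ->]]; have [l [u [-> u1]]] := isoc_unit_decomposition L.
rewrite isocZ expmx_symmetry ?isoc_unit //; last exact: comm_isoc_Kmx.
exact: (double_rotation_comm 2^-1 (comm_isoc_Kmx u)).
Qed.

(** [isoc u] and [K] are skew and commute, so the idempotents are symmetric and transposition only
    negates the sines, which gives the inverse double rotation. *)
Lemma symmetry_group_orthogonal (S : M4) : symmetry_group S -> S^T *m S = 1%:M.
Proof.
move=> [L [t ->]]; have [l [u [-> u1]]] := isoc_unit_decomposition L.
have AK := comm_isoc_Kmx u; have AA := isoc_unit u1.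
rewrite isocZ expmx_symmetry //.
set c := cos _; set s := sin _; set c' := cos _; set s' := sin _.
rewrite -[RHS](@double_rotationK _ _ _ _ _ half2 AA Kmx_sqr AK c s c' s') ?cos2Dsin2 //.
congr (_ * _); rewrite /double_rotation.
have Ap := comm_idempotent 2^-1 AK; have Aq := comm_coidempotent 2^-1 AK.
have trM (X Y : M4) : (X * Y)^T = Y^T * X^T by exact: trmx_mul.
have trAK : (isoc u * K)^T = isoc u * K.
  by rewrite trM tr_isoc tr_Kmx mulrN mulNr opprK.
have tr1 : (1 : M4)^T = 1 by exact: trmx1.
have trp : (2^-1 *: (1 + isoc u * K))^T = 2^-1 *: (1 + isoc u * K).
  by rewrite linearZ linearD /= trAK tr1.
have trq : (2^-1 *: (1 - isoc u * K))^T = 2^-1 *: (1 - isoc u * K).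
  by rewrite linearZ linearB /= trAK tr1.
have trE x y (r : M4) : GRing.comm (isoc u : M4) r ->
    r * (x *: 1 + y *: isoc u)^T = (x *: 1 + (- y) *: isoc u) * r.
  move=> Ar; rewrite linearD !linearZ /= tr1 tr_isoc scalerN -scaleNr.
  by rewrite mulrDl mulrDr -!scalerAl -!scalerAr mulr1 mul1r Ar.
by rewrite linearD /= !trM trp trq !trE.
Qed.

Lemma symmetry_group_isoc (u : 'cV[R]_3) : \sum_i (u i 0) ^+ 2 = 1 -> symmetry_group (isoc u).
Proof.
(* With length pi and tau = 0 both angles are pi/2, so the rotation on each range is [isoc u]
   itself. *)
move=> u1; exists (pi *: u), 0.
rewrite isocZ expmx_symmetry ?isoc_unit //; last exact: comm_isoc_Kmx.
rewrite /double_rotation subr0 addr0 mulrC cos_pihalf sin_pihalf scale0r add0r scale1r.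
by rewrite -mulrDr idempotentD // mulr1.
Qed.

Lemma symmetry_group_Kmx : symmetry_group K.
Proof.
pose u : 'cV[R]_3 := delta_mx 0 0.
have u1 : \sum_i (u i 0) ^+ 2 = 1 by exact: delta_unit.
(* The zero vector is written as a multiple of a unit vector to supply a complex structure A. The
   angles are -pi/2 and pi/2, and -Ap + Aq = -A(AK) = K. *)
exists (0 *: u), pi.
rewrite isocZ expmx_symmetry ?isoc_unit //; last exact: comm_isoc_Kmx.
rewrite /double_rotation sub0r add0r mulrN cosN sinN mulrC cos_pihalf sin_pihalf.
rewrite scale0r !add0r scaleN1r scale1r mulNr addrC -mulrBr idempotentB //.
by rewrite mulrN mulrA isoc_unit // mulN1r opprK.
Qed.

End SymmetryGroup.

(** * Real bilinear forms attached to complex matrices *)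

Section InvariantForms.
Context {R : realType}.
Local Open Scope sesquilinear_scope.
Local Open Scope classical_set_scope.
Local Notation K := (Kmx R).
Local Notation C := R[i].
Local Notation Remx := (map_mx (@complex.Re R)).
Local Notation Immx := (map_mx (@complex.Im R)).

Lemma Re_mulmx k l n (A : 'M[C]_(k, l)) (B : 'M[C]_(l, n)) :
  Remx (A *m B) = Remx A *m Remx B - Immx A *m Immx B.
Proof.
apply/matrixP => i j.
rewrite !mxE (big_morph (@complex.Re R) (id1 := 0) (op1 := +%R)) //; last first.
  by case=> ? ? [].
rewrite -sumrB; apply: eq_bigr => r _; rewrite !mxE.
by case: (A i r) => ? ?; case: (B r j).
Qed.

Lemma Im_mulmx k l n (A : 'M[C]_(k, l)) (B : 'M[C]_(l, n)) :
  Immx (A *m B) = Remx A *m Immx B + Immx A *m Remx B.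
Proof.
apply/matrixP => i j.
rewrite !mxE (big_morph (@complex.Im R) (id1 := 0) (op1 := +%R)) //; last first.
  by case=> ? ? [].
rewrite -big_split; apply: eq_bigr => r _; rewrite !mxE.
by case: (A i r) => ? ?; case: (B r j).
Qed.

Section Gradient.
Variable N : nat.
Implicit Types (g h : 'M[C]_N) (X Y : 'M[R]_(4, N)).

(* [K] plays the role of [i] on [R^4]: [cgrad g X] is the product [X g]. *)
Definition cgrad g X : 'M[R]_(4, N) := X *m Remx g + K *m X *m Immx g.

(** Defined for every complex [g]: taking the adjoint of [g] swaps the arguments, so the Hermitian
    [g] are those that give symmetric forms. *)
Definition cform g X Y : R := \tr (cgrad g X *m Y^T).

Lemma cgradP g a X Y : cgrad g (a *: X + Y) = a *: cgrad g X + cgrad g Y.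
Proof.
rewrite /cgrad mulmxDr !mulmxDl -scalemxAr -!scalemxAl.
by rewrite scalerDr addrACA.
Qed.

Lemma cformPl g a X X' Y : cform g (a *: X + X') Y = a * cform g X Y + cform g X' Y.
Proof. by rewrite /cform cgradP mulmxDl -scalemxAl raddfD /= mxtraceZ. Qed.

Lemma cformPr g a X Y Y' : cform g X (a *: Y + Y') = a * cform g X Y + cform g X Y'.
Proof. by rewrite /cform linearP mulmxDr -scalemxAr raddfD /= mxtraceZ. Qed.

Lemma cformD g h X Y : cform (g + h) X Y = cform g X Y + cform h X Y.
Proof.
rewrite /cform -raddfD -mulmxDl /=; congr (\tr (_ *m _)); rewrite /cgrad.
have -> : Remx (g + h) = Remx g + Remx h.
  by apply/matrixP => i j; rewrite !mxE; case: (g i j) => ? ?; case: (h i j).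
have -> : Immx (g + h) = Immx g + Immx h.
  by apply/matrixP => i j; rewrite !mxE; case: (g i j) => ? ?; case: (h i j).
by rewrite !mulmxDr addrACA.
Qed.

Lemma cformZ (a : R) g X Y : cform (a%:C *: g) X Y = a * cform g X Y.
Proof.
rewrite /cform -mxtraceZ scalemxAl; congr (\tr (_ *m _)); rewrite /cgrad.
have -> : Remx (a%:C *: g) = a *: Remx g.
  by apply/matrixP => i j; rewrite !mxE; case: (g i j) => ? ? /=; ring.
have -> : Immx (a%:C *: g) = a *: Immx g.
  by apply/matrixP => i j; rewrite !mxE; case: (g i j) => ? ? /=; ring.
by rewrite -!scalemxAr scalerDr.
Qed.

Lemma Re_trmxC g : Remx (g^t*) = (Remx g)^T.
Proof. by apply/matrixP => i j; rewrite !mxE; case: (g j i). Qed.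

Lemma Im_trmxC g : Immx (g^t*) = - (Immx g)^T.
Proof. by apply/matrixP => i j; rewrite !mxE; case: (g j i). Qed.

Lemma tr_cgrad g X : (cgrad g X)^T = Remx (g^t*) *m X^T + Immx (g^t*) *m X^T *m K.
Proof.
rewrite Re_trmxC Im_trmxC linearD /= !trmx_mul tr_Kmx.
by rewrite mulmxN mulNmx mulmxN mulmxA !mulNmx.
Qed.

Lemma cform_trmxC g X Y : cform (g^t*) X Y = cform g Y X.
Proof.
rewrite /cform -[RHS]mxtrace_tr trmx_mul trmxK tr_cgrad mulmxDr mulmxDl !raddfD /=.
by congr (_ + _); rewrite !mulmxA // [RHS]mxtrace_mulC !mulmxA.
Qed.

(** [S] passes through [cgrad] because it commutes with [K]; cyclicity of the trace then brings it
    next to its transpose. *)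
Lemma cform_invariant g (S : 'M[R]_4) X Y : S^T *m S = 1%:M -> S *m K = K *m S ->
  cform g (S *m X) (S *m Y) = cform g X Y.
Proof.
move=> SS SK; rewrite /cform.
have -> : cgrad g (S *m X) = S *m cgrad g X.
  by rewrite /cgrad mulmxDr !mulmxA SK.
by rewrite trmx_mul mulmxA mxtrace_mulC !mulmxA SS mul1mx.
Qed.

Lemma cform_delta g X a k : cform g X (delta_mx a k) = cgrad g X a k.
Proof.
rewrite /cform trmx_delta; move: (cgrad g X) => G.
rewrite /mxtrace (bigD1 a) //= mxE (bigD1 k) //= mxE !eqxx mulr1.
rewrite big1 ?addr0 => [|j /negbTE jk]; last by rewrite mxE jk mulr0.
rewrite big1 ?addr0 // => b /negbTE ba; rewrite mxE big1 // => j _.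
by rewrite mxE ba andbF mulr0.
Qed.

Lemma cform_deltas g a b k l : cform g (delta_mx a k) (delta_mx b l) =
  complex.Re (g k l) *+ (a == b) + K b a * complex.Im (g k l).
Proof.
rewrite cform_delta /cgrad mxE; move: K => J; congr (_ + _).
  rewrite mxE (bigD1 k) //= big1 ?addr0 => [|j /negbTE jk]; last by rewrite mxE jk andbF mul0r.
  by rewrite !mxE eqxx andbT eq_sym; case: eqP; rewrite ?mul1r ?mul0r.
rewrite mxE (bigD1 k) //= big1 ?addr0 => [|j /negbTE jk].
  rewrite !mxE (bigD1 a) //= big1 ?addr0 => [|j /negbTE jk].
    by rewrite mxE !eqxx mulr1.
  by rewrite mxE jk mulr0.
rewrite mxE big1 ?mul0r // => c _; by rewrite mxE jk andbF mulr0.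
Qed.

Lemma cform_eq0 g : (forall X Y, cform g X Y = 0) -> g = 0.
Proof.
move=> g0; apply/matrixP => k l; rewrite mxE; apply/eqP; rewrite eq_complex /=.
(* Equal row indices isolate the real part of an entry, since the diagonal of [K] is zero; rows 0
   and 3 isolate the imaginary part, since [K] has entry 1 there. *)
have := g0 (delta_mx 0 k) (delta_mx 0 l); rewrite cform_deltas !mxE /= mul0r addr0 mulr1n => ->.
have := g0 (delta_mx 0 k) (delta_mx ord_max l).
rewrite cform_deltas !mxE /= mul1r mulr0n add0r => ->.
by rewrite eqxx.
Qed.

(* The gradient of [X |-> cform h X X] is twice [cgrad h X], so this is the
   bracket of two such forms up to a factor 4. *)
Lemma cgrad_symplectic g h (J : 'M[R]_N) X : h^t* = h ->
  \tr (cgrad g X *m J *m (cgrad h X)^T) = cform (g *m map_mx (real_complex R) J *m h) X X.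
Proof.
move=> hJ; rewrite tr_cgrad hJ /cform /cgrad.
have JR : Remx (map_mx (real_complex R) J) = J by apply/matrixP => i j; rewrite !mxE.
have JI : Immx (map_mx (real_complex R) J) = 0 by apply/matrixP => i j; rewrite !mxE.
rewrite !(Re_mulmx, Im_mulmx) JR JI !(mulmx0, mul0mx, subr0, add0r, addr0).
rewrite !mulmxDl !mulmxDr !mulmxA !mulmxDl !raddfD /= !mulmxN !mulNmx raddfN /=.
have KK : K *m K = - 1%:M :> 'M[R]_4 := Kmx_sqr.
rewrite ![\tr (_ *m K)]mxtrace_mulC !mulmxA KK !mulNmx mul1mx !raddfN /=; ring.
Qed.

End Gradient.

(** For nonzero t the difference quotient is [b v x + b x v + t * b v v], and its last term tends to
    0. *)
Lemma derive_quadratic (V : normedModType R) (b : V -> V -> R^o) (x v : V) :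
  (forall a y y' z, b (a *: y + y') z = a * b y z + b y' z) ->
  (forall a y z z', b y (a *: z + z') = a * b y z + b y z') ->
  'D_v (fun z => b z z) x = b v x + b x v.
Proof.
move=> bl br; apply: cvg_lim; first exact: norm_hausdorff.
have: (fun t : R => (b v x + b x v) + t * b v v) @ 0^' --> (b v x + b x v : R^o).
  rewrite -[X in _ --> X]addr0 -[X in _ --> _ + X](mul0r (b v v)).
  apply: cvg_within_filter.
  by apply: cvgD; [exact: cvg_cst | apply: cvgMr_tmp; exact: cvg_id].
apply: cvg_trans; apply: near_eq_cvg; near=> t => /=.
have t0 : t != 0 by near: t; exact: nbhs_dnbhs_neq.
rewrite /shift /= bl !br -[RHS]/(_ * _); field.
by [].
Unshelve. all: by end_near.
Qed.

(** * Hermitian forms on phase space and their Poisson brackets *)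

Section Forms.
Variable m : nat.
Local Notation J := (symplectic_mx m).
Local Notation Jc := (@csymplectic_mx R m).
Implicit Types (g h : 'M[C]_(m + m)) (z : phase_space R m).

Definition flat z : 'M[R]_(4, m + m) := row_mx z.1 z.2.

Definition hform g z : R^o := cform g (flat z) (flat z).

Lemma flatP (a : R) z z' : flat (a *: z + z') = a *: flat z + flat z'.
Proof. by rewrite /flat scale_row_mx add_row_mx. Qed.

Definition phase_form g z z' : R^o := cform g (flat z) (flat z').

Lemma phase_form_bilinear g : bilinear_for *:%R *:%R (phase_form g).
Proof.
split => [z' a x y|z a x y]; rewrite /phase_form flatP.
- exact: cformPl.
- exact: cformPr.
Qed.

HB.instance Definition _ g := bilinear_isBilinear.Build R (phase_space R m)
  (phase_space R m) R^o *:%R *:%R (phase_form g) (phase_form_bilinear g).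

Lemma hform_quadratic g : quadratic_form (hform g).
Proof. by exists (phase_form g). Qed.

Lemma hform_invariant g : invariant_quadratic_forms (hform g).
Proof.
split=> [|S GS z]; first exact: hform_quadratic.
rewrite /hform /flat /= -mul_mx_row; apply: cform_invariant.
- exact: symmetry_group_orthogonal.
- exact: symmetry_group_commute.
Qed.

Lemma derive_hform h v z : h^t* = h ->
  'D_v (hform h) z = 2 * cform h (flat z) (flat v).
Proof.
move=> hJ; rewrite (derive_quadratic (b := phase_form h)).
- by rewrite /phase_form -{1}hJ cform_trmxC -mulr2n mulr_natl.
- by move=> a x y z'; rewrite /phase_form flatP cformPl.
- by move=> a x y z'; rewrite /phase_form flatP cformPr.
Qed.

Lemma tr_symplectic (X Y : 'M[R]_(4, m + m)) :
  \tr (X *m J *m Y^T) = \sum_(i < m) \sum_(a < 4)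
    (X a (lshift m i) * Y a (rshift m i) - X a (rshift m i) * Y a (lshift m i)).
Proof.
rewrite exchange_big /=; apply: eq_bigr => a _.
rewrite -{1}[X]hsubmxK -{1}[Y]hsubmxK tr_row_mx mul_row_block mul_row_col.
rewrite !(mulmx0, mulmx1, mulmxN, add0r, addr0) mulNmx !mxE addrC -sumrB.
by apply: eq_bigr => i _; rewrite !mxE.
Qed.

Lemma csymplectic_trmxC : Jc^t* = - Jc.
Proof.
rewrite /csymplectic_mx /symplectic_mx tr_block_mx map_block_mx trmx0 map_mx0 linearN /= map_mxN.
by rewrite trmx1 map_mx1 opp_block_mx !oppr0 opprK.
Qed.

(** The gradients give the form of 4gJh. On the diagonal a matrix and its adjoint define the same
    form, so gJh may be replaced by its Hermitian part, half of gJh - hJg. *)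
Lemma poisson_hform g h : g^t* = g -> h^t* = h ->
  poisson (hform g) (hform h) = hform (2 *: (g *m Jc *m h - h *m Jc *m g)).
Proof.
move=> gJ hJ; apply/funext => z; rewrite /poisson.
have flat_deltaQ i a : flat ((delta_mx a i, 0) : phase_space R m) = delta_mx a (lshift m i).
  rewrite /flat /=; apply/matrixP => b k; rewrite mxE.
  by case: split_ordP => k' ->; rewrite !mxE ?eq_lshift // eq_rlshift andbF.
have flat_deltaP i a : flat ((0, delta_mx a i) : phase_space R m) = delta_mx a (rshift m i).
  rewrite /flat /=; apply/matrixP => b k; rewrite mxE.
  by case: split_ordP => k' ->; rewrite !mxE ?eq_rshift // eq_lrshift andbF.
transitivity (4 * \tr (cgrad g (flat z) *m J *m (cgrad h (flat z))^T)).
  rewrite tr_symplectic !mulr_sumr; apply: eq_bigr => i _; rewrite mulr_sumr.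
  apply: eq_bigr => a _; rewrite /dQ /dP !derive_hform // flat_deltaQ flat_deltaP !cform_delta.
  by ring.
rewrite cgrad_symplectic // /hform.
have JC : map_mx (real_complex R) J = Jc.
  by rewrite /csymplectic_mx /symplectic_mx map_block_mx !map_mx0 map_mxN !map_mx1.
rewrite JC -[2 in RHS](rmorph_nat (real_complex R)) cformZ cformD.
(* J is skew-Hermitian while [g] and [h] are Hermitian, hence the sign. *)
have -> : - (h *m Jc *m g) = (g *m Jc *m h)^t*.
  by rewrite !trmxC_mul gJ hJ csymplectic_trmxC mulNmx mulmxN mulmxA.
by rewrite cform_trmxC; ring.
Qed.

Lemma hform_inj g h : g^t* = g -> h^t* = h -> hform g = hform h -> g = h.
Proof.
move=> gJ hJ gh; apply/eqP; rewrite -subr_eq0; apply/eqP.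
have dJ : (g - h)^t* = g - h by rewrite trmxCB gJ hJ.
have d0 z : hform (g - h) z = 0.
  rewrite /hform cformD -[- h]scaleN1r -(rmorphN1 (real_complex R)) cformZ mulN1r.
  by rewrite -!/(hform _ _) gh subrr.
have X0 X : cform (g - h) X X = 0.
  by have := d0 (lsubmx X, rsubmx X); rewrite /hform /flat /= hsubmxK.
(* Polarisation: a symmetric form that vanishes on the diagonal vanishes everywhere. *)
apply: cform_eq0 => X Y.
have := X0 (1 *: X + Y); rewrite cformPl !cformPr !X0 mulr0 addr0 add0r !mul1r.
rewrite -{1}dJ cform_trmxC -mulr2n => /eqP; rewrite mulrn_eq0 /= => /eqP YX.
by rewrite -dJ cform_trmxC.
Qed.
End Forms.
End InvariantForms.

(** * The commutant of the symmetry group *)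

Section Commutant.
Context {R : realType}.
Local Notation K := (Kmx R).

Lemma isoc_delta0 : isoc (delta_mx (inord 0) 0 : 'cV[R]_3) = mx_of_rows 4 4
  [:: [:: 0; 0; 0; -1]; [:: 0; 0; -1; 0]; [:: 0; 1; 0; 0]; [:: 1; 0; 0; 0]].
Proof.
rewrite isocE !mxE -!val_eqE /= !inordK //=.
by apply/matrixP => -[[|[|[|[|//]]]] ?] [[|[|[|[|//]]]] ?]; rewrite !mxE /= ?oppr0.
Qed.

Lemma isoc_delta1 : isoc (delta_mx (inord 1) 0 : 'cV[R]_3) = mx_of_rows 4 4
  [:: [:: 0; 0; 1; 0]; [:: 0; 0; 0; -1]; [:: -1; 0; 0; 0]; [:: 0; 1; 0; 0]].
Proof.
rewrite isocE !mxE -!val_eqE /= !inordK //=.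
by apply/matrixP => -[[|[|[|[|//]]]] ?] [[|[|[|[|//]]]] ?]; rewrite !mxE /= ?oppr0.
Qed.

Lemma isoc_delta2 : isoc (delta_mx (inord 2) 0 : 'cV[R]_3) = mx_of_rows 4 4
  [:: [:: 0; -1; 0; 0]; [:: 1; 0; 0; 0]; [:: 0; 0; 0; -1]; [:: 0; 0; 1; 0]].
Proof.
rewrite isocE !mxE -!val_eqE /= !inordK //=.
by apply/matrixP => -[[|[|[|[|//]]]] ?] [[|[|[|[|//]]]] ?]; rewrite !mxE /= ?oppr0.
Qed.

(** Commutation is spelled out entry by entry over numeral indices, so that explicit [rows] give
    linear equations in the unknowns [c], ready for [lra]. *)
Lemma mx_of_rows_comm (c : nat -> nat -> R) (rows : seq (seq R))
    (M := \matrix_(i < 4, j < 4) c i j) (u := fun i j => nth 0 (nth [::] rows i) j) :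
  M *m mx_of_rows 4 4 rows = mx_of_rows 4 4 rows *m M -> forall k l, (k < 4)%N -> (l < 4)%N ->
  c k 0%N * u 0%N l + c k 1%N * u 1%N l + c k 2%N * u 2%N l + c k 3%N * u 3%N l =
  u k 0%N * c 0%N l + u k 1%N * c 1%N l + u k 2%N * c 2%N l + u k 3%N * c 3%N l.
Proof.
move=> /matrixP comm k l k4 l4; have := comm (Ordinal k4) (Ordinal l4).
by rewrite !mxE !big_ord_recl !big_ord0 !mxE !addr0 /= !addrA.
Qed.

(* A matrix commuting with right multiplication by unit quaternions is a left
   multiplication; commuting with [K] as well leaves the span of [1] and [K]. *)
Lemma symmetry_group_commutant (M : 'M[R]_4) :
  (forall S, symmetry_group S -> S^T *m M *m S = M) ->
  forall a b, M a b = M 0 0 *+ (a == b) + K b a * M 0 ord_max.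
Proof.
move=> inv.
have comm S : symmetry_group S -> M *m S = S *m M.
  move=> GS; rewrite -{2}(inv S GS) !mulmxA.
  by rewrite (mulmx1C (symmetry_group_orthogonal GS)) mul1mx.
pose c i j := M (inord i) (inord j).
have ME : M = \matrix_(i < 4, j < 4) c i j by apply/matrixP => i j; rewrite mxE /c !inord_val.
have comm_c rows : symmetry_group (mx_of_rows 4 4 rows) ->
    \matrix_(i, j) c i j *m mx_of_rows 4 4 rows = mx_of_rows 4 4 rows *m \matrix_(i, j) c i j.
  by rewrite -ME; exact: comm.
(* The last column of each commutation relation suffices: three quaternion units and [K] give
   sixteen linear equations for the entries of [M]. *)
have c3 rows (GS : symmetry_group (mx_of_rows 4 4 rows)) k (k4 : (k < 4)%N) :=
  mx_of_rows_comm (comm_c rows GS) k4 (isT : (3 < 4)%N).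
have G0 := eq_ind _ (@symmetry_group R) (symmetry_group_isoc (delta_unit (inord 0))) _ isoc_delta0.
have G1 := eq_ind _ (@symmetry_group R) (symmetry_group_isoc (delta_unit (inord 1))) _ isoc_delta1.
have G2 := eq_ind _ (@symmetry_group R) (symmetry_group_isoc (delta_unit (inord 2))) _ isoc_delta2.
have GK := symmetry_group_Kmx (R := R).
have cE (i j : 'I_4) : M i j = c i j by rewrite /c !inord_val.
move=> a b; rewrite !cE.
move: (c3 _ G0 0%N isT) (c3 _ G0 1%N isT) (c3 _ G0 2%N isT) (c3 _ G0 3%N isT).
move: (c3 _ G1 0%N isT) (c3 _ G1 1%N isT) (c3 _ G1 2%N isT) (c3 _ G1 3%N isT).
move: (c3 _ G2 0%N isT) (c3 _ G2 1%N isT) (c3 _ G2 2%N isT) (c3 _ G2 3%N isT).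
move: (c3 _ GK 0%N isT) (c3 _ GK 1%N isT) (c3 _ GK 2%N isT) (c3 _ GK 3%N isT).
rewrite /= => *.
by case: a => -[|[|[|[|//]]]] ?; case: b => -[|[|[|[|//]]]] ?; rewrite mxE -val_eqE /=; lra.
Qed.
End Commutant.

(** * Every invariant quadratic form comes from a Hermitian matrix *)

Section Classification.
Context {R : realType}.
Local Open Scope sesquilinear_scope.
Local Notation K := (Kmx R).
Local Notation C := R[i].

Lemma bilinear_delta_ext k l (s t : 'M[R]_(k, l) -> 'M[R]_(k, l) -> R) :
  (forall a X X' Y, s (a *: X + X') Y = a * s X Y + s X' Y) ->
  (forall a X Y Y', s X (a *: Y + Y') = a * s X Y + s X Y') ->
  (forall a X X' Y, t (a *: X + X') Y = a * t X Y + t X' Y) ->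
  (forall a X Y Y', t X (a *: Y + Y') = a * t X Y + t X Y') ->
  (forall i j i' j', s (delta_mx i j) (delta_mx i' j') = t (delta_mx i j) (delta_mx i' j')) ->
  forall X Y, s X Y = t X Y.
Proof.
have expand (f : 'M[R]_(k, l) -> R) X : (forall a Y Y', f (a *: Y + Y') = a * f Y + f Y') ->
    f X = \sum_i \sum_j X i j * f (delta_mx i j).
  move=> fL; pose F := GRing.isLinear.Build R 'M[R]_(k, l) R^o *:%R f fL.
  pose f' : {linear 'M[R]_(k, l) -> R^o} := HB.pack f F.
  rewrite {1}[X]matrix_sum_delta -[f]/(f' : _ -> _) linear_sum; apply: eq_bigr => i _.
  by rewrite linear_sum; apply: eq_bigr => j _; rewrite linearZ.
move=> sl sr tl tr st X Y.
rewrite (expand (s^~ Y)) // (expand (t^~ Y)) //; apply: eq_bigr => i _.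
apply: eq_bigr => j _; congr (_ * _); rewrite (expand (s _)) // (expand (t _)) //.
by apply: eq_bigr => i' _; apply: eq_bigr => j' _; rewrite st.
Qed.

(** The polar form of [f] is cut into 4 x 4 blocks indexed by pairs of columns. Invariance puts each
    block in the span of 1 and [K], and its two coefficients make up one complex entry of [h]. *)
Lemma hform_surj m (f : phase_space R m -> R^o) : invariant_quadratic_forms f ->
  exists2 h : 'M[C]_(m + m), h^t* = h & f = hform h.
Proof.
move=> [[b bE] inv].
pose unflat (X : 'M[R]_(4, m + m)) : phase_space R m := (lsubmx X, rsubmx X).
have unflatP a X Y : unflat (a *: X + Y) = a *: unflat X + unflat Y.
  by rewrite /unflat !linearP.
have flatK z : unflat (flat z) = z.
  by case: z => Q P; rewrite /unflat /flat row_mxKl row_mxKr.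
(* The given [b] may be neither symmetric nor invariant. Its symmetrisation is determined by [f],
   hence inherits the invariance of [f]. *)
pose s X Y : R := 2^-1 * (b (unflat X) (unflat Y) + b (unflat Y) (unflat X)).
have sC X Y : s X Y = s Y X by rewrite /s addrC.
have sP a X Y Z : s (a *: X + Y) Z = a * s X Z + s Y Z.
  rewrite /s unflatP linearPl linearPr /= -![_ *: _]/(_ * _); ring.
have sE X Y : s X Y = 2^-1 * (f (unflat (X + Y)) - f (unflat X) - f (unflat Y)).
  rewrite /s -[X in X + Y]scale1r unflatP scale1r !bE linearDl !linearDr /=; ring.
have sinv S X Y : symmetry_group S -> s (S *m X) (S *m Y) = s X Y.
  move=> GS.
  have act Z : f (unflat (S *m Z)) = f (unflat Z).
    rewrite -[RHS](inv S GS); congr f.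
    by rewrite /unflat /diagonal_action /= mulmx_lsub mulmx_rsub.
  by rewrite !sE -mulmxDr !act.
pose M k l : 'M[R]_4 := \matrix_(a, b) s (delta_mx a k) (delta_mx b l).
have Minv k l S : symmetry_group S -> S^T *m M k l *m S = M k l.
  have entry (A : 'M[R]_4) a c :
      ((delta_mx a 0 : 'cV_4)^T *m A *m (delta_mx c 0 : 'cV_4)) 0 0 = A a c.
    by rewrite trmx_delta -rowE -colE !mxE.
  (* Matrices with a single nonzero column let [S] act on a block through the vectors [u] and
     [v]. *)
  have sM (u v : 'cV[R]_4) : s (u *m delta_mx 0 k) (v *m delta_mx 0 l) = (u^T *m M k l *m v) 0 0.
    apply: (bilinear_delta_ext (s := fun u v => s (u *m delta_mx 0 k) (v *m delta_mx 0 l))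
      (t := fun u v => (u^T *m M k l *m v) 0 0)) => [x y y' w|x w y y'|x y y' w|x w y y'|a j c j'].
    - by rewrite mulmxDl -scalemxAl sP.
    - by rewrite mulmxDl -scalemxAl sC sP ![s _ (w *m _)]sC.
    - by rewrite linearP !mulmxDl -!scalemxAl !mxE.
    - by rewrite mulmxDr -scalemxAr !mxE.
    by rewrite !ord1 !mul_delta_mx entry mxE.
  move=> GS; apply/matrixP => a c; rewrite [RHS]mxE -(sinv S) // -entry.
  rewrite -[delta_mx a k](mul_delta_mx (0 : 'I_1)) -[delta_mx c l](mul_delta_mx (0 : 'I_1)).
  by rewrite !mulmxA sM trmx_mul !mulmxA.
pose h : 'M[C]_(m + m) := \matrix_(k, l) (M k l 0 0 +i* M k l 0 ord_max).
exists h.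
  apply/matrixP => k l; rewrite [LHS]mxE [X in Num.conj X]mxE !mxE.
  (* Exchanging k and l transposes the block, because [s] is symmetric; this keeps the coefficient
     of 1 and negates that of the skew matrix [K], so [h] is Hermitian. *)
  have := symmetry_group_commutant (Minv k l) ord_max 0.
  rewrite [K _ _]mxE /= mulr0n add0r mulN1r !mxE => skl.
  apply/eqP; rewrite -[Num.conj _]/(conjc _) eq_complex /= sC eqxx /=.
  by rewrite [s (delta_mx 0 l) _]sC skl opprK.
apply/funext => z; rewrite /hform -[in LHS](flatK z).
have -> : f (unflat (flat z)) = s (flat z) (flat z).
  by rewrite /s bE; field.
apply: bilinear_delta_ext => //.
- by move=> a X Y Y'; rewrite ![s X _]sC.
- exact: cformPl.
- exact: cformPr.
move=> a k c l.
have := symmetry_group_commutant (Minv k l) a c; rewrite cform_deltas mxE => ->.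
by rewrite /h !mxE.
Qed.
End Classification.

(** Between two factors, J J = -1 removes the inner J, so h(A) J h(B) is a multiple of J times the
    conjugate of AB. The condition on [c] and [d] matches the remaining scalars. *)
Lemma conj_bracket {F : fieldType} n (c d : F) (J P X Y : 'M[F]_n)
    (h := fun Z => c *: (J *m (invmx P *m Z *m P))) :
  J *m J = - 1%:M -> P \in unitmx -> d * (c * c) = - c ->
  d *: (h X *m J *m h Y - h Y *m J *m h X) = h (X *m Y - Y *m X).
Proof.
move=> JJ Punit dcc.
have conjM A B : invmx P *m A *m P *m (invmx P *m B *m P) = invmx P *m (A *m B) *m P.
  by rewrite !mulmxA mulmxK.
have hM A B : h A *m J *m h B = - (c * c) *: (J *m (invmx P *m (A *m B) *m P)).
  rewrite /h -conjM -!scalemxAl -scalemxAr scalerA -!mulmxA (mulmxA J J) JJ.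
  by rewrite mulNmx mul1mx !mulmxN scalerN scaleNr.
rewrite !hM -scalerBr scalerA mulrN dcc opprK /h.
by rewrite -mulmxBr -mulmxBl -mulmxBr.
Qed.

(** * The isomorphism between the unitary algebra and the invariant forms *)

Section MomentMap.
Context {R : realType} {m : nat}.
Local Open Scope sesquilinear_scope.
Local Open Scope classical_set_scope.
Local Notation C := R[i].
Local Notation J := (@csymplectic_mx R m).
Variables H P : 'M[C]_(m + m).
Hypotheses (Punit : P \in unitmx) (HP : P^t* *m H *m P = 'i *: J).

(* The factor 1/2 absorbs the factor 2 of [poisson_hform]. *)
Definition hermitian_of (M : realified_mx R (m + m) (m + m)) : 'M[C]_(m + m) :=
  (- 2^-1)%:C *: (J *m (invmx P *m (M : 'M[C]_(m + m)) *m P)).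

Definition moment_form (M : realified_mx R (m + m) (m + m)) : phase_space R m -> R^o :=
  hform (hermitian_of M).

Let JJ : J *m J = - 1%:M := csymplectic_mx_sqr m.

(** The inverse of [hermitian_of]: as J has inverse -J, the factor -J/2 is undone by 2J. *)
Definition unitary_of (h : 'M[C]_(m + m)) : realified_mx R (m + m) (m + m) :=
  P *m (2%:C *: (J *m h)) *m invmx P.

Let half2 : (- 2^-1)%:C * 2%:C = -1 :> C.
Proof. by rewrite -rmorphM /= mulNr mulVf ?pnatr_eq0 // rmorphN1. Qed.

Lemma hermitian_ofK : cancel hermitian_of unitary_of.
Proof.
move=> M; rewrite /unitary_of /hermitian_of -!scalemxAr -!scalemxAl scalerA.
rewrite mulrC half2 scaleN1r (mulmxA J) JJ mulNmx mul1mx mulmxN mulNmx opprK.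
by rewrite -!mulmxA mulKVmx // mulmxV // mulmx1.
Qed.

Lemma unitary_ofK : cancel unitary_of hermitian_of.
Proof.
move=> h; rewrite /unitary_of /hermitian_of -!mulmxA mulVmx // mulmx1 mulKmx //.
by rewrite -scalemxAr scalerA half2 mulmxA JJ mulNmx mul1mx scaleN1r opprK.
Qed.

(** Congruence by [P] turns HM into iX with X = J P^-1 M P, and iX is skew-Hermitian exactly when X
    is Hermitian. *)
Lemma unitary_hermitian_of M :
  unitary_lie_algebra H M <-> (hermitian_of M)^t* = hermitian_of M.
Proof.
set X := J *m (invmx P *m (M : 'M[C]_(m + m)) *m P).
have PHMP : P^t* *m (H *m (M : 'M[C]_(m + m))) *m P = 'i *: X.
  by rewrite scalemxAl -HP !mulmxA mulmxK.
have PHMJ : P^t* *m ((H *m (M : 'M[C]_(m + m)))^t* + H *m (M : 'M[C]_(m + m))) *m P =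
    'i *: (X - X^t*).
  have PA (A : 'M[C]_(m + m)) : P^t* *m A^t* *m P = (P^t* *m A *m P)^t*.
    by rewrite !trmxC_mul trmxCK mulmxA.
  have iJ : conjc 'i%C = - 'i%C :> C by rewrite /= -[RHS]/(_ +i* _) oppr0.
  by rewrite mulmxDr mulmxDl PA PHMP trmxCZ iJ scaleNr scalerBr addrC.
have i0 : 'i%C != 0 :> C by rewrite eq_complex /= oner_eq0 andbF.
have h0 : (- 2^-1 : R)%:C != 0 by rewrite fmorph_eq0 oppr_eq0 invr_eq0 pnatr_eq0.
rewrite /hermitian_of -/X trmxCZ conjc_real /unitary_lie_algebra /=.
split => [HM|/(scalerI h0) XJ].
  move: PHMJ; rewrite HM mulmx0 mul0mx => /esym/eqP.
  by rewrite scaler_eq0 (negbTE i0) subr_eq0 => /eqP <-.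
(* Conversely, [P] and its adjoint are invertible and can be cancelled from the congruence. *)
move: PHMJ; rewrite XJ subrr scaler0 => /(congr1 (mulmx^~ (invmx P))).
rewrite mulmxK // mul0mx => /(congr1 (mulmx (invmx (P^t*)))).
by rewrite mulmx0 mulKmx // map_unitmx unitmx_tr.
Qed.

Lemma moment_form_bij :
  set_bij (unitary_lie_algebra H) (@invariant_quadratic_forms R m) moment_form.
Proof.
split=> [M _|M M'|f /hform_surj [h hJ ->]].
- exact: hform_invariant.
- rewrite !inE => /unitary_hermitian_of hM /unitary_hermitian_of hM' eqMM.
  exact: (can_inj hermitian_ofK (hform_inj hM hM' eqMM)).
exists (unitary_of h); last by rewrite /moment_form unitary_ofK.
by apply/unitary_hermitian_of; rewrite unitary_ofK.
Qed.

Lemma moment_form_linear a M N : moment_form (a *: M + N) = a *: moment_form M + moment_form N.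
Proof.
have -> : moment_form (a *: M + N) = hform (a%:C *: hermitian_of M + hermitian_of N).
  congr hform; rewrite /hermitian_of realified_scaleE mulmxDr mulmxDl mulmxDr.
  by rewrite -!(scalemxAl, scalemxAr) scalerDr !scalerA mulrC.
by apply/funext => z; rewrite /hform cformD cformZ.
Qed.

Lemma moment_form_commutator M N : unitary_lie_algebra H M -> unitary_lie_algebra H N ->
  moment_form (commutator M N) = poisson (moment_form M) (moment_form N).
Proof.
move=> /unitary_hermitian_of hM /unitary_hermitian_of hN.
rewrite /moment_form (poisson_hform hM hN); congr hform.
apply/esym/(conj_bracket _ _ JJ Punit).
by rewrite -[2](rmorph_nat (real_complex R)) -!rmorphM -rmorphN /=; congr _%:C; field.
Qed.

End MomentMap.

Theorem theorem5p1 (R : realType) (n m : nat)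
    (n_ge2 : (2 <= n)%N) (m_def : m = (n * (n - 1) %/ 2)%N)
    (H : 'M[R[i]]_(m + m))
    (H_hermitian : H \is hermsymmx) (H_signature : has_signature H m m) :
  lie_isomorphic (@invariant_quadratic_forms R m) (@poisson R m)
                 (unitary_lie_algebra H) (@commutator R (m + m)).
Proof.
have [P Punit HP] := hermitian_congr_symplectic H_hermitian H_signature.
apply: (lie_isomorphic_of_bij (psi := moment_form P)).
- exact: unitary_is_lie_algebra.
- exact: moment_form_bij.
- by move=> a x y _ _; exact: moment_form_linear.
- exact: moment_form_commutator.
Qed.
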